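(* Let $l$ be a closed polygonal line and $p$ a non-closed polygonal line in the plane such that the vertices of $l$ and $p$ are pairwise distinct and in general position. Denote by $P_0$ and $P_1$ the initial and final points of $p$. Then: (a) $w(l,P_1)-w(l,P_0)\equiv |l\cap p| \pmod 2$. (b) $w(l,P_1)\equiv |l\cap p| \pmod 2$ if the point $P_0$ is sufficiently far from $l$ (for example, outside the convex hull of $l$).
   Context: All points are in the plane $\mathbb{R}^2$. For points $A,B\neq O$ (possibly $A=B$), the oriented angle $\angle AOB$ is the number $t\in(-\pi,\pi]$ such that $\overrightarrow{OB}$ is a positive multiple of the vector obtained from $\overrightarrow{OA}$ by counterclockwise rotation through $t$. A (non-closed) polygonal line $Q_1\ldots Q_n$ is an ordered tuple of points; its initial and final points are $Q_1$ and $Q_n$, and its segments are $Q_jQ_{j+1}$, $1\le j\le n-1$. A closed polygonal line $A_1\ldots A_m$ is also an ordered tuple of points; its segments are $A_iA_{i+1}$, $1\le i\le m$, where $A_{m+1}:=A_1$. The winding number of a closed polygonal line $l=A_1\ldots A_m$ around a point $O$ not on it is $w(l,O):=\frac{1}{2\pi}\sum_{i=1}^{m}\angle A_iOA_{i+1}$. Several points are in general position if no three of them lie on a line and no three segments joining them have a common interior point. In the notation $l\cap p$, each of the polygonal lines is regarded as the union of its segments, and $|l\cap p|$ is the number of points of this intersection.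
   Formalization: The closed polygonal line l is assumed not to have exactly two vertices: for l = A₁A₂ its two segments coincide, all winding numbers are 0, and a line p crossing A₁A₂ once gives |l∩p| = 1, so the claim fails. *)

(* Defs.v *)
From mathcomp Require Import all_boot all_order all_algebra finmap.
From mathcomp Require Import all_classical all_reals all_analysis.

Set Implicit Arguments.
Unset Strict Implicit.
Unset Printing Implicit Defensive.

Import Order.TTheory GRing.Theory Num.Theory.
Local Open Scope classical_set_scope.
Local Open Scope ring_scope.

Notation plane R := 'rV[R]_2.

Section Plane.
Context {R : realType}.
Implicit Types (A B O : plane R) (S : set (plane R)) (l p : seq (plane R)).

(* The sup norm that the library puts on matrices is not the Euclidean one. *)
Definition euclid_dist A B : R := Num.sqrt (\sum_i (A 0 i - B 0 i) ^+ 2).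

Definition rotate (t : R) (v : plane R) : plane R :=
  \row_i if i == 0 then cos t * v 0 0 - sin t * v 0 1
         else sin t * v 0 0 + cos t * v 0 1.

(* For A, B != O exactly one t satisfies the condition; otherwise the value
   is irrelevant. *)
Definition angle A O B : R :=
  xget 0 [set t : R | - pi < t <= pi /\
    exists2 c : R, 0 < c & B - O = c *: rotate t (A - O)].

Definition segment A B : set (plane R) :=
  [set (1 - t) *: A + t *: B | t in `[0, 1]].

Definition open_segment A B : set (plane R) :=
  [set (1 - t) *: A + t *: B | t in `]0, 1[].

(* [:: (A_1, A_2); ...; (A_m, A_1)] *)
Definition closed_edges l := zip l (rot 1 l).

(* [:: (Q_1, Q_2); ...; (Q_(n-1), Q_n)]: zip drops the unmatched Q_n *)
Definition edges p := zip p (behead p).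

Definition union_segments (es : seq (plane R * plane R)) : set (plane R) :=
  \bigcup_(e in [set` es]) segment e.1 e.2.

Definition closed_polyline l := union_segments (closed_edges l).

Definition polyline p := union_segments (edges p).

Definition winding l O : R :=
  (2 * pi)^-1 * \sum_(e <- closed_edges l) angle e.1 O e.2.

Definition collinear S :=
  exists a b c : R, (a, b) != (0, 0) /\
    forall X, S X -> a * X 0 0 + b * X 0 1 = c.

Definition joins S (s : plane R * plane R) :=
  [/\ S s.1, S s.2 & s.1 != s.2].

(* Segments are compared as sets of points, so that AB and BA coincide. *)
Definition general_position S :=
  (forall A B C, S A -> S B -> S C -> A != B -> A != C -> B != C ->
     ~ collinear [set A; B; C]) /\
  (forall s1 s2 s3, joins S s1 -> joins S s2 -> joins S s3 ->
     segment s1.1 s1.2 <> segment s2.1 s2.2 ->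
     segment s1.1 s1.2 <> segment s3.1 s3.2 ->
     segment s2.1 s2.2 <> segment s3.1 s3.2 ->
     ~ exists X, [/\ open_segment s1.1 s1.2 X, open_segment s2.1 s2.2 X
                   & open_segment s3.1 s3.2 X]).

Definition convex_hull S : set (plane R) :=
  \bigcap_(C in [set C | convex_set C /\ S `<=` C]) C.

(* The cardinality is meaningful only for finite S: fset_set is empty
   otherwise. *)
Definition npoints S : nat := #|` fset_set S|%fset.

(* Congruence modulo 2; winding numbers are real by definition. *)
Definition eqmod2 (x y : R) := exists k : int, x - y = 2 * k%:~R.

End Plane.

(* Main.v *)
(** For a segment PQ and a closed line A_1 ... A_m, the numbers
    theta_i = angle P A_i Q telescope to 0 around the closed line. Hence
    w(l, Q) - w(l, P) is the sum over the edges AB of l of the multiples of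
    2 pi given by
      (angle A Q B + angle P A Q) - (angle A P B + angle P B Q),
    divided by 2 pi. This is the oriented angle sum of the quadrilateral AQBP.
    If AB and PQ cross, the quadrilateral is convex, all four angles turn in
    the same direction and the sum is +-2 pi; otherwise it is 0. Summing over
    the edges PQ of p gives (a), because general position makes distinct
    crossing pairs of edges meet in distinct points. If P_0 is outside the
    convex hull, the directions from P_0 to the vertices lie in an open
    half-plane, so w(l, P_0) = 0 and (b) follows. *)

Require Import Defs.
From mathcomp Require Import all_boot all_order all_algebra finmap.
From mathcomp Require Import all_classical all_reals all_analysis.
From mathcomp Require Import ring lra.

Set Implicit Arguments.
Unset Strict Implicit.
Unset Printing Implicit Defensive.

Import Order.TTheory GRing.Theory Num.Theory.
Local Open Scope classical_set_scope.
Local Open Scope ring_scope.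

(** * Oriented angles through dot products and orientations *)

Section Angles.
Context {R : realType}.
Implicit Types (A B C O P Q X : plane R) (t : R).

Lemma polar_form (x y : R) : (x, y) != (0, 0) ->
  exists t rho, [/\ - pi < t <= pi, 0 < rho, x = rho * cos t & y = rho * sin t].
Proof.
move=> xy0.
have n0 : 0 < x ^+ 2 + y ^+ 2.
  rewrite lt_neqAle addr_ge0 ?sqr_ge0// andbT eq_sym paddr_eq0 ?sqr_ge0//.
  by rewrite !sqrf_eq0; move: xy0; rewrite xpair_eqE.
pose rho := Num.sqrt (x ^+ 2 + y ^+ 2).
have r0 : 0 < rho by rewrite sqrtr_gt0.
have r2 : rho ^+ 2 = x ^+ 2 + y ^+ 2 by rewrite sqr_sqrtr// ltW.
have xr : (x / rho) ^+ 2 <= 1.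
  by rewrite expr_div_n ler_pdivrMr ?exprn_gt0// mul1r r2 lerDl sqr_ge0.
have x1 : -1 <= x / rho <= 1.
  by rewrite -ler_norml -(@ler_pXn2r _ 2)// ?nnegrE// real_normK ?num_real// expr1n.
have sE : sin (acos (x / rho)) = `|y| / rho.
  rewrite sin_acos//.
  have -> : 1 - (x / rho) ^+ 2 = (`|y| / rho) ^+ 2.
    rewrite !expr_div_n real_normK ?num_real//.
    have -> : y ^+ 2 = rho ^+ 2 - x ^+ 2 by rewrite r2; ring.
    by field; rewrite gt_eqF.
  by rewrite sqrtr_sqr ger0_norm// divr_ge0// ltW.
have cE : cos (acos (x / rho)) = x / rho by rewrite acosK// in_itv.
have rK z : rho * (z / rho) = z by rewrite mulrC mulfVK// gt_eqF.
have p0 := pi_gt0 R.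
have t0 := acos_ge0 x1; have tpi := acos_lepi x1.
have [y0|y0] := lerP 0 y.
  exists (acos (x / rho)), rho; split=> //; first by lra.
    by rewrite cE rK.
  by rewrite sE rK ger0_norm.
(* The range of [t] excludes [- pi], so the arccosine must be shown to differ from [pi] before it is
   negated. *)
have tpi' : acos (x / rho) < pi.
  rewrite lt_neqAle tpi andbT; apply/eqP => E; move: sE.
  rewrite E sinpi => /esym/eqP; rewrite mulf_eq0 normr_eq0 invr_eq0.
  by rewrite (lt_eqF y0) (gt_eqF r0).
exists (- acos (x / rho)), rho; split=> //; first by lra.
  by rewrite cosN cE rK.
by rewrite sinN sE mulrN rK ltr0_norm// opprK.
Qed.

(** The double angle formula makes the sine of t / 2 vanish, and |t / 2| < pi. This turns a
    congruence modulo 2 pi into an equality once a bound is known. *)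
Lemma cos_eq1 t : cos t = 1 -> - (2 * pi) < t < 2 * pi -> t = 0.
Proof.
move=> ct /andP[t1 t2]; have p0 := pi_gt0 R.
have : cos (t / 2 *+ 2) = 1 by rewrite -mulr_natr mulfVK.
rewrite cos_mulr2n => c2.
have s0 : sin (t / 2) = 0.
  by apply/eqP; rewrite -sqrf_eq0 sin2cos2; apply/eqP; lra.
have [tn|tp|//] := ltgtP t 0.
  have : 0 < sin (- (t / 2)) by apply: sin_gt0_pi; lra.
  by rewrite sinN s0 oppr0 ltxx.
have : 0 < sin (t / 2) by apply: sin_gt0_pi; lra.
by rewrite s0 ltxx.
Qed.

Lemma sin_gt0_itv t : - pi < t <= pi -> 0 < sin t -> 0 < t < pi.
Proof.
move=> /andP[t1 t2] s0; apply/andP; split.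
  rewrite ltNge; apply/negP => tn.
  have [t0|/eqP t0] := eqVneq t 0; first by move: s0; rewrite t0 sin0 ltxx.
  have : 0 < sin (- t) by apply: sin_gt0_pi; lra.
  by rewrite sinN; lra.
rewrite lt_neqAle t2 andbT; apply/eqP => t0.
by move: s0; rewrite t0 sinpi ltxx.
Qed.

Lemma sin_gt0_add_lt_pi t : 0 < t < 2 * pi -> 0 < sin t -> t < pi.
Proof.
move=> /andP[t1 t2] s0; rewrite ltNge; apply/negP => tp.
have [tE|/eqP tn] := eqVneq t pi; first by move: s0; rewrite tE sinpi ltxx.
have : 0 < sin (t - pi) by apply: sin_gt0_pi; lra.
by rewrite sinB sinpi cospi; lra.
Qed.

Lemma planeP A B : A 0 0 = B 0 0 -> A 0 1 = B 0 1 -> A = B.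
Proof.
move=> e0 e1; apply/rowP => -[[|[|//]] i].
  by rewrite (_ : Ordinal i = 0)//; apply/val_inj.
by rewrite (_ : Ordinal i = 1)//; apply/val_inj.
Qed.

Lemma plane_neq A B : A != B -> (B 0 0 - A 0 0, B 0 1 - A 0 1) != (0, 0).
Proof.
apply: contra_neq => -[/eqP + /eqP]; rewrite !subr_eq0 => /eqP e0 /eqP e1.
exact: planeP.
Qed.

(** In complex notation [dot] and [orient] are the real and imaginary parts of conj(A - O) (B - O);
    [orient] is also twice the signed area of OAB. *)
Definition dot O A B : R :=
  (A 0 0 - O 0 0) * (B 0 0 - O 0 0) + (A 0 1 - O 0 1) * (B 0 1 - O 0 1).

Definition orient O A B : R :=
  (A 0 0 - O 0 0) * (B 0 1 - O 0 1) - (A 0 1 - O 0 1) * (B 0 0 - O 0 0).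

Lemma dot_gt0 O A : A != O -> 0 < dot O A A.
Proof.
rewrite eq_sym => /plane_neq; rewrite /dot -!expr2 xpair_eqE => n0.
rewrite lt_neqAle addr_ge0 ?sqr_ge0// andbT eq_sym paddr_eq0 ?sqr_ge0//.
by rewrite !sqrf_eq0.
Qed.

Lemma angleP A O B : A != O -> B != O -> - pi < angle A O B <= pi /\
  exists2 rho : R, 0 < rho & dot O A B = rho * cos (angle A O B) /\
                   orient O A B = rho * sin (angle A O B).
Proof.
move=> AO BO; have a0 := dot_gt0 AO; have b0 := dot_gt0 BO.
have n0 : (dot O A B, orient O A B) != (0, 0).
  apply: contraTneq a0 => -[d0 o0]; rewrite -leNgt.
  (* Lagrange's identity: [dot] and [orient] cannot both vanish when A and B differ from O. *)
  have : dot O A A * dot O B B = dot O A B ^+ 2 + orient O A B ^+ 2.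
    by rewrite /dot /orient; ring.
  rewrite d0 o0 expr0n addr0 => /eqP; rewrite mulf_eq0 (gt_eqF b0) orbF.
  by move/eqP->.
have [t [rho [tpi r0 dE oE]]] := polar_form n0.
have ex : exists t, [set t : R | - pi < t <= pi /\
    exists2 c : R, 0 < c & B - O = c *: rotate t (A - O)] t.
  (* The scale factor comes from |A - O|^2 (B - O) = (A - O) (dot + i orient). *)
  exists t; split=> //; exists (rho / dot O A A); first exact: divr_gt0.
  have a1 := lt0r_neq0 a0.
  apply: planeP; rewrite !mxE /=; apply: (mulfI a1).
    transitivity ((A 0 0 - O 0 0) * dot O A B - (A 0 1 - O 0 1) * orient O A B).
      by rewrite /dot /orient; ring.
    by rewrite dE oE; field.
  transitivity ((A 0 1 - O 0 1) * dot O A B + (A 0 0 - O 0 0) * orient O A B).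
    by rewrite /dot /orient; ring.
  by rewrite dE oE; field.
have [{}tpi [c c0 cE]] := xgetPex 0 ex.
split=> //; exists (c * dot O A A); first exact: mulr_gt0.
have e0 : B 0 0 - O 0 0 = c * (rotate (angle A O B) (A - O)) 0 0.
  by have := congr1 (fun M : plane R => M 0 0) cE; rewrite !mxE.
have e1 : B 0 1 - O 0 1 = c * (rotate (angle A O B) (A - O)) 0 1.
  by have := congr1 (fun M : plane R => M 0 1) cE; rewrite !mxE.
by rewrite /dot /orient e0 e1 !mxE /=; split; ring.
Qed.
End Angles.

(** * The oriented angle sum of a quadrilateral *)

Section Quadrilateral.
Context {R : realType}.
Implicit Types (A B C O P Q X : plane R) (t : R).

Lemma cos_eq1_polar t (rho : R) : 0 < rho ->
  rho * sin t = 0 -> 0 < rho * cos t -> cos t = 1.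
Proof.
move=> r0 /eqP; rewrite mulf_eq0 (gt_eqF r0)/= => /eqP s0.
rewrite pmulr_rgt0// => c0; have := cos2Dsin2 t.
rewrite s0 expr0n addr0 => /eqP; rewrite sqrf_eq1 => /orP[/eqP//|/eqP c1].
by move: c0; rewrite c1; lra.
Qed.

Lemma angle_self A O : A != O -> angle A O A = 0.
Proof.
move=> AO; have [/andP[t1 t2] [rho r0 [dE oE]]] := angleP AO AO.
have p0 := pi_gt0 R; apply: cos_eq1; last by lra.
apply: (cos_eq1_polar r0); first by rewrite -oE /orient; ring.
by rewrite -dE dot_gt0.
Qed.

(** With O as origin, conj(A) B conj(B) C times the conjugate of conj(A) C is |A|^2 |B|^2 |C|^2, a
    positive real, so its argument is a multiple of 2 pi. *)
Lemma angle_add A B C O : A != O -> B != O -> C != O ->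
  cos (angle A O B + angle B O C - angle A O C) = 1.
Proof.
move=> AO BO CO.
have [_ [r1 r10 [d1 o1]]] := angleP AO BO.
have [_ [r2 r20 [d2 o2]]] := angleP BO CO.
have [_ [r3 r30 [d3 o3]]] := angleP AO CO.
apply: (@cos_eq1_polar _ (r1 * r2 * r3)); first by rewrite !mulr_gt0.
  transitivity ((orient O A B * dot O B C + dot O A B * orient O B C) * dot O A C
     - (dot O A B * dot O B C - orient O A B * orient O B C) * orient O A C).
    by rewrite d1 o1 d2 o2 d3 o3 sinB sinD cosD; ring.
  by rewrite /dot /orient; ring.
suff -> : r1 * r2 * r3 * cos (angle A O B + angle B O C - angle A O C)
   = dot O A A * dot O B B * dot O C C by rewrite !mulr_gt0 ?dot_gt0.
transitivity ((orient O A B * dot O B C + dot O A B * orient O B C) * orient O A C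
     + (dot O A B * dot O B C - orient O A B * orient O B C) * dot O A C).
  by rewrite d1 o1 d2 o2 d3 o3 cosB sinD cosD; ring.
by rewrite /dot /orient; ring.
Qed.

Lemma angle_orient_gt0 A O B : A != O -> B != O ->
  0 < orient O A B -> 0 < angle A O B < pi.
Proof.
move=> AO BO o0; have [tpi [rho r0 [_ oE]]] := angleP AO BO.
by apply: sin_gt0_itv => //; move: o0; rewrite oE pmulr_rgt0.
Qed.

Lemma angle_orient_lt0 A O B : A != O -> B != O ->
  orient O A B < 0 -> - pi < angle A O B < 0.
Proof.
move=> AO BO o0; have [/andP[t1 t2] [rho r0 [_ oE]]] := angleP AO BO.
have s0 : sin (angle A O B) < 0 by move: o0; rewrite oE pmulr_rlt0.
rewrite t1 /= ltNge; apply/negP => tp.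
suff : 0 <= sin (angle A O B) by rewrite leNgt s0.
have [->|tn] := eqVneq (angle A O B) pi; first by rewrite sinpi.
have [->|t0] := eqVneq (angle A O B) 0; first by rewrite sin0.
by apply/ltW/sin_gt0_pi; rewrite !lt_neqAle eq_sym t0 tp tn.
Qed.

Lemma orient_eq0r A B : orient A B B = 0. Proof. by rewrite /orient; ring. Qed.
Lemma orient_eq0l A B : orient A A B = 0. Proof. by rewrite /orient; ring. Qed.
Lemma orient_eq0m A B : orient A B A = 0. Proof. by rewrite /orient; ring. Qed.

Lemma orient_neq A B C : orient A B C != 0 -> [/\ B != A, C != A & C != B].
Proof.
move=> o0; split; apply: contra_neq o0 => ->.
- exact: orient_eq0l.
- exact: orient_eq0m.
- exact: orient_eq0r.
Qed.

Definition angle_defect A B P Q : R :=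
  (angle A Q B + angle P A Q) - (angle A P B + angle P B Q).

(** A sign test, so that crossings can be summed over pairs of edges; [crosses_meet] and
    [segment_meet] tie it to actual common points. *)
Definition crosses A B P Q : bool :=
  (orient P A B * orient Q A B < 0) && (orient A P Q * orient B P Q < 0).

(* In complex notation, with K and D the imaginary and real parts of
   (Q - B) conj(P - A), both sums of two adjacent angles have argument
   arg (D + i K): the first because
   (B - Q) conj(A - Q) (Q - A) conj(P - A) = |A - Q|^2 (D + i K). *)
Let K A B P Q : R := orient Q A B + orient B P Q.
Let D A B P Q : R :=
  (Q 0 0 - B 0 0) * (P 0 0 - A 0 0) + (Q 0 1 - B 0 1) * (P 0 1 - A 0 1).

Section Defect.
Variables A B P Q : plane R.
Hypotheses (oQ : orient Q A B != 0) (oP : orient P A B != 0).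
Hypotheses (oA : orient A P Q != 0) (oB : orient B P Q != 0).

Lemma adjacent_angles_Q :
  exists2 rho : R, 0 < rho &
    rho * sin (angle A Q B + angle P A Q) = K A B P Q /\
    rho * cos (angle A Q B + angle P A Q) = D A B P Q.
Proof.
have [AQ BQ _] := orient_neq oQ; have [PA QA _] := orient_neq oA.
have [_ [r1 r10 [d1 o1]]] := angleP AQ BQ.
have [_ [r4 r40 [d4 o4]]] := angleP PA QA.
have a0 := dot_gt0 AQ; have a1 := lt0r_neq0 a0.
exists (r1 * r4 / dot Q A A); first by rewrite divr_gt0// mulr_gt0.
split; apply: (mulfI a1).
  transitivity (orient Q A B * dot A P Q + dot Q A B * orient A P Q).
    by rewrite d1 o1 d4 o4 sinD; field.
  by rewrite /K /dot /orient; ring.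
transitivity (dot Q A B * dot A P Q - orient Q A B * orient A P Q).
  by rewrite d1 o1 d4 o4 cosD; field.
by rewrite /D /dot /orient; ring.
Qed.

(** Here (B - P) conj(A - P) (Q - B) conj(P - B) = |P - B|^2 (D + i K), because two sign changes
    cancel. *)
Lemma adjacent_angles_P :
  exists2 rho : R, 0 < rho &
    rho * sin (angle A P B + angle P B Q) = K A B P Q /\
    rho * cos (angle A P B + angle P B Q) = D A B P Q.
Proof.
have [AP BP _] := orient_neq oP; have [PB QB _] := orient_neq oB.
have [_ [r1 r10 [d1 o1]]] := angleP AP BP.
have [_ [r4 r40 [d4 o4]]] := angleP PB QB.
have a0 := dot_gt0 PB; have a1 := lt0r_neq0 a0.
exists (r1 * r4 / dot B P P); first by rewrite divr_gt0// mulr_gt0.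
split; apply: (mulfI a1).
  transitivity (orient P A B * dot B P Q + dot P A B * orient B P Q).
    by rewrite d1 o1 d4 o4 sinD; field.
  by rewrite /K /dot /orient; ring.
transitivity (dot P A B * dot B P Q - orient P A B * orient B P Q).
  by rewrite d1 o1 d4 o4 cosD; field.
by rewrite /D /dot /orient; ring.
Qed.

Lemma cos_angle_defect : cos (angle_defect A B P Q) = 1.
Proof.
have [r1 r10 [s1 c1]] := adjacent_angles_Q.
have [r2 r20 [s2 c2]] := adjacent_angles_P.
have KD : r1 * r2 * sin (angle_defect A B P Q) = 0.
  transitivity (K A B P Q * D A B P Q - D A B P Q * K A B P Q); last by ring.
  by rewrite -[X in X * _ - _]s1 -[X in _ * X - _]c2 -[X in _ - X * _]c1
    -[X in _ - _ * X]s2 sinB; ring.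
have DK : r1 * r2 * cos (angle_defect A B P Q) = D A B P Q ^+ 2 + K A B P Q ^+ 2.
  rewrite !expr2 -[X in X * _ + _]c1 -[X in _ * X + _]c2.
  by rewrite -[X in _ + X * _]s1 -[X in _ + _ * X]s2 cosB; ring.
apply: (cos_eq1_polar _ KD); first by rewrite mulr_gt0.
by rewrite DK -c1 -s1 !exprMn -mulrDr cos2Dsin2 mulr1 exprn_gt0.
Qed.

Let angle_sign O X Y : orient O X Y != 0 ->
  orient O X Y < 0 /\ - pi < angle X O Y < 0 \/
  0 < orient O X Y /\ 0 < angle X O Y < pi.
Proof.
move=> o0; have [XO YO _] := orient_neq o0.
have [oneg|opos|/eqP] := ltgtP (orient O X Y) 0; last by rewrite (negPf o0).
- by left; split=> //; exact: angle_orient_lt0.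
- by right; split=> //; exact: angle_orient_gt0.
Qed.

(** Both sides are the determinant of Q - P and A - B. The identity discards sign patterns of the
    four orientations that no configuration realizes. *)
Let area : orient Q A B - orient P A B = orient A P Q - orient B P Q.
Proof. by rewrite /orient; ring. Qed.

(** By [area], all four angles contribute to the defect with the same sign. Each contribution is
    smaller than pi in absolute value, so the defect is nonzero and below 4 pi in absolute value;
    being a multiple of 2 pi, it is 2 pi or its opposite. *)
Lemma angle_defect_crosses : crosses A B P Q ->
  angle_defect A B P Q = 2 * pi \/ angle_defect A B P Q = - (2 * pi).
Proof.
rewrite /crosses !mulr_lt0 oQ oP oA oB /= => cr.
have p0 := pi_gt0 R; have := cos_angle_defect.
suff : 0 < angle_defect A B P Q < 4 * pi \/
       - (4 * pi) < angle_defect A B P Q < 0.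
  have p2 : 2 * pi = pi *+ 2 :> R by rewrite mulr_natl.
  case=> S c1; [left|right].
    apply/eqP; rewrite -subr_eq0; apply/eqP/cos_eq1; last by lra.
    by rewrite p2 cosB cos2pi sin2pi c1; ring.
  apply/eqP; rewrite -addr_eq0; apply/eqP/cos_eq1; last by lra.
  by rewrite p2 cosD cos2pi sin2pi c1; ring.
move: cr area (angle_sign oQ) (angle_sign oP) (angle_sign oA) (angle_sign oB).
rewrite /angle_defect.
(* The geometry is forgotten here: signs, angle ranges and [area] leave only linear arithmetic over
   the sign patterns. *)
move: (orient Q A B) (orient P A B) (orient A P Q) (orient B P Q).
move: (angle A Q B) (angle A P B) (angle P A Q) (angle P B Q) p0.
move: pi => p xQ xP xA xB p0 a b c d cr ar.
case=> -[sQ hQ]; case=> -[sP hP]; case=> -[sA hA]; case=> -[sB hB];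
  move: cr; rewrite ?sQ ?sP ?sA ?sB ?(lt_gtF sQ) ?(lt_gtF sP) ?(lt_gtF sA)
  ?(lt_gtF sB) //= => _; first [by exfalso; lra|by left; lra|by right; lra].
Qed.

(** It suffices to bound the defect strictly between -2 pi and 2 pi. The signs of the four
    orientations alone leave too wide a range; the sign of [K], shared by the sines of both sums of
    adjacent angles, bounds these sums by pi from above or by -pi from below. *)
Lemma angle_defect_not_crosses : ~~ crosses A B P Q ->
  angle_defect A B P Q = 0.
Proof.
rewrite /crosses !mulr_lt0 oQ oP oA oB /= => ncr.
have p0 := pi_gt0 R; apply: (cos_eq1 cos_angle_defect).
have [rQ rQ0 [KQ _]] := adjacent_angles_Q.
have [rP rP0 [KP _]] := adjacent_angles_P.
have posK t rho : 0 < rho -> rho * sin t = K A B P Q ->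
    t < 2 * pi -> 0 < K A B P Q -> t < pi.
  move=> r0 <- t2 /[!pmulr_rgt0]// s0; have [tn|tp] := lerP t 0; first by lra.
  by apply: sin_gt0_add_lt_pi; rewrite ?tp.
have negK t rho : 0 < rho -> rho * sin t = K A B P Q ->
    - (2 * pi) < t -> K A B P Q < 0 -> - pi < t.
  move=> r0 <- t2 /[!pmulr_rlt0]// s0; have [tn|tp] := lerP 0 t; first by lra.
  suff : - t < pi by lra.
  by apply: sin_gt0_add_lt_pi; [lra|rewrite sinN oppr_gt0].
move: {posK negK} (posK _ _ rQ0 KQ) (negK _ _ rQ0 KQ) (posK _ _ rP0 KP) (negK _ _ rP0 KP).
move: ncr area (angle_sign oQ) (angle_sign oP) (angle_sign oA) (angle_sign oB).
rewrite /angle_defect /K {rQ rQ0 KQ rP rP0 KP}.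
move: (orient Q A B) (orient P A B) (orient A P Q) (orient B P Q).
move: (angle A Q B) (angle A P B) (angle P A Q) (angle P B Q) p0.
move: pi => p xQ xP xA xB p0 a b c d ncr ar sQ sP sA sB.
have uQ : xQ + xA < 2 * p by move: sQ sA => [] [_ ?] [] [_ ?]; lra.
have lQ : - (2 * p) < xQ + xA by move: sQ sA => [] [_ ?] [] [_ ?]; lra.
have uP : xP + xB < 2 * p by move: sP sB => [] [_ ?] [] [_ ?]; lra.
have lP : - (2 * p) < xP + xB by move: sP sB => [] [_ ?] [] [_ ?]; lra.
move=> /(_ uQ) pQ /(_ lQ) nQ /(_ uP) pP /(_ lP) nP.
(* The sum [a + d] is the value of [K]; when it is zero, the signs of the orientations suffice. *)
have {pQ nQ pP nP uQ lQ uP lP} : a + d = 0 \/ 0 < a + d /\ (xQ + xA < p /\ xP + xB < p) \/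
    a + d < 0 /\ (- p < xQ + xA /\ - p < xP + xB).
  have [lt|gt|eq] := ltgtP (a + d) 0; last by left.
    by right; right; split; [|split; [exact: nQ|exact: nP]].
  by right; left; split; [|split; [exact: pQ|exact: pP]].
case: sQ => -[sQ hQ]; case: sP => -[sP hP]; case: sA => -[sA hA];
  case: sB => -[sB hB];
  move: ncr; rewrite ?sQ ?sP ?sA ?sB ?(lt_gtF sQ) ?(lt_gtF sP) ?(lt_gtF sA)
  ?(lt_gtF sB) //= => _; case=> [k0|[[k0 [? ?]]|[k0 [? ?]]]]; lra.
Qed.

End Defect.

End Quadrilateral.

(** * Crossing segments and their common point *)

Section Segments.
Context {R : realType}.
Implicit Types (A B C O P Q X Y : plane R) (S : set (plane R)) (t s : R).

Lemma orient_collinear A B C : A != B -> orient A B C = 0 ->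
  collinear [set A; B; C].
Proof.
move=> AB o0; exists (B 0 1 - A 0 1), (A 0 0 - B 0 0).
exists (A 0 0 * B 0 1 - B 0 0 * A 0 1); split.
  apply: contra_neq AB => -[e1 e0]; apply: planeP; apply/eqP.
    by rewrite -subr_eq0 e0.
  by rewrite eq_sym -subr_eq0 e1.
move=> X [[->|->]|->]; [ring|ring|].
by move: o0; rewrite /orient => o0; lra.
Qed.

Lemma general_position_orient S A B C : general_position S ->
  S A -> S B -> S C -> A != B -> A != C -> B != C -> orient A B C != 0.
Proof.
move=> [+ _] SA SB SC AB AC BC => /(_ A B C SA SB SC AB AC BC).
by apply: contra_notN => /eqP; exact: orient_collinear.
Qed.

Definition point_at A B t : plane R := (1 - t) *: A + t *: B.

Lemma point_atE A B t i : point_at A B t 0 i = (1 - t) * A 0 i + t * B 0 i.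
Proof. by rewrite !mxE. Qed.

Lemma orient_point_at A B P Q s : orient (point_at P Q s) A B =
  (1 - s) * orient P A B + s * orient Q A B.
Proof. by rewrite /orient !point_atE; ring. Qed.

Lemma segmentP A B X : segment A B X <->
  exists2 t, 0 <= t <= 1 & X = point_at A B t.
Proof.
split=> [[t /= + <-]|[t t01 ->]]; first by rewrite in_itv/=; exists t.
by exists t => //=; rewrite in_itv.
Qed.

Lemma segment_orient A B X : segment A B X -> orient X A B = 0.
Proof.
by move=> /segmentP[t _ ->]; rewrite orient_point_at /orient; ring.
Qed.

Lemma segment_left A B : segment A B A.
Proof.
by apply/segmentP; exists 0; rewrite ?lexx ?ler01// /point_at subr0 scale1r scale0r addr0.
Qed.

(** The orientation relative to AB is an affine function along PQ; the parameter is the zero of this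
    function. *)
Definition meet A B P Q : plane R :=
  point_at P Q (orient P A B / (orient P A B - orient Q A B)).

Let area A B P Q :
  orient Q A B - orient P A B = orient A P Q - orient B P Q.
Proof. by rewrite /orient; ring. Qed.

Let weight01 (x y : R) : x * y < 0 -> x - y != 0 /\ 0 < x / (x - y) < 1.
Proof.
rewrite mulr_lt0 => /and3P[x0 y0 /addbP xy].
have [xn|xp|/eqP] := ltgtP x 0; last by rewrite (negPf x0).
  have yp : 0 < y by rewrite lt0r y0 leNgt -xy xn.
  have d0 : x - y < 0 by lra.
  rewrite lt_eqF// nmulr_rgt0 ?invr_lt0// d0 ltr_ndivrMr//; split=> //=; lra.
have yn : y < 0 by rewrite -[y < 0]negbK -xy (lt_gtF xp).
have d0 : 0 < x - y by lra.
by rewrite gt_eqF// divr_gt0// ltr_pdivrMr//; split=> //=; lra.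
Qed.

(** The formula places the point on PQ by construction; this symmetry places it on AB as well. *)
Lemma meetC A B P Q : crosses A B P Q -> meet P Q A B = meet A B P Q.
Proof.
move=> /andP[/weight01[d1 _] _].
have mE i : (orient P A B - orient Q A B) * (meet A B P Q) 0 i =
    (orient P A B - orient Q A B) * P 0 i + orient P A B * (Q 0 i - P 0 i).
  by rewrite /meet point_atE; field.
have mE' i : (orient P A B - orient Q A B) * (meet P Q A B) 0 i =
    (orient P A B - orient Q A B) * A 0 i - orient A P Q * (B 0 i - A 0 i).
  rewrite /meet -(area A B P Q) -[orient Q A B - orient P A B]opprB point_atE.
  by field; rewrite ?oppr_eq0 ?d1.
by apply: planeP; apply: (mulfI d1); rewrite mE mE' /orient; ring.
Qed.

Lemma crosses_meet A B P Q : crosses A B P Q ->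
  open_segment A B (meet A B P Q) /\ open_segment P Q (meet A B P Q).
Proof.
move=> cr; have /andP[/weight01[_ w1] /weight01[_ w2]] := cr; split.
  by rewrite -meetC//; exists (orient A P Q / (orient A P Q - orient B P Q)).
by exists (orient P A B / (orient P A B - orient Q A B)).
Qed.

Lemma open_segmentW A B X : open_segment A B X -> segment A B X.
Proof.
move=> [t /=]; rewrite in_itv/= => /andP[t0 t1] <-.
by apply/segmentP; exists t; rewrite ?(ltW t0) ?(ltW t1).
Qed.

Let between_lt0 (x y t : R) : x != 0 -> y != 0 -> 0 <= t <= 1 ->
  (1 - t) * x + t * y = 0 -> x * y < 0.
Proof.
move=> x0 y0 /andP[t0 t1] e; rewrite mulr_lt0 x0 y0 /=.
have [xn|xp|/eqP] := ltgtP x 0; last by rewrite (negPf x0).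
  have [yn|//] := ltP y 0; first by move: e; nra.
have [//|yp] := ltP y 0; move: e y0; rewrite le_eqVlt in yp; nra.
Qed.

(** At X both affine orientation functions vanish. As they are nonzero at the endpoints, they change
    sign between them, which is the crossing test; the zero also determines the parameter of X. *)
Lemma segment_meet A B P Q X :
  orient P A B != 0 -> orient Q A B != 0 ->
  orient A P Q != 0 -> orient B P Q != 0 ->
  segment A B X -> segment P Q X -> crosses A B P Q /\ X = meet A B P Q.
Proof.
move=> oP oQ oA oB XAB XPQ.
have o1 := segment_orient XAB; have o2 := segment_orient XPQ.
have [t t01 Xt] := (segmentP _ _ _).1 XAB.
have [s s01 Xs] := (segmentP _ _ _).1 XPQ.
rewrite Xt orient_point_at in o2; rewrite Xs orient_point_at in o1.
have cr : crosses A B P Q.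
  by rewrite /crosses (between_lt0 oP oQ s01 o1) (between_lt0 oA oB t01 o2).
split=> //; rewrite Xs /meet; congr point_at.
have /andP[/weight01[d _] _] := cr.
by apply: (mulIf d); rewrite mulfVK//; lra.
Qed.

End Segments.

(** * Edge lists of closed and open polygonal lines *)

Section Edges.
Context {R : realType}.
Implicit Types (A B C O P Q X Y : plane R) (l p : seq (plane R)).
Implicit Types (e f : plane R * plane R).

Lemma closed_edges_nth l e x0 : e \in closed_edges l ->
  exists2 i, (i < size l)%N & e = (nth x0 l i, nth x0 l (i.+1 %% size l)).
Proof.
have sz : size l = size (rot 1 l) by rewrite size_rot.
move=> /(nthP (x0, x0))[i]; rewrite size_zip -sz minnn => il <-.
exists i => //; rewrite nth_zip//; congr pair.
case: l sz il => [//|x s] _ il; rewrite rot1_cons nth_rcons.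
move: il; rewrite ltnS leq_eqVlt => /orP[/eqP ->|il].
  by rewrite ltnn eqxx modnn.
by rewrite il modn_small.
Qed.

Lemma edges_nth p f x0 : f \in edges p ->
  exists2 i, (i.+1 < size p)%N & f = (nth x0 p i, nth x0 p i.+1).
Proof.
case: p => [//|x s] /(nthP (x0, x0))[i].
rewrite size_zip /= (minn_idPr (leqnSn _)) => il <-; exists i => //.
by rewrite nth_zip_cond size_zip /= (minn_idPr (leqnSn _)) il.
Qed.

Lemma mem_closed_edges l e : e \in closed_edges l -> (e.1 \in l) && (e.2 \in l).
Proof.
move=> /(closed_edges_nth 0)[i il ->] /=.
by rewrite !mem_nth// ltn_mod (leq_ltn_trans _ il).
Qed.

Lemma mem_edges p f : f \in edges p -> (f.1 \in p) && (f.2 \in p).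
Proof.
by move=> /(edges_nth 0)[i il ->] /=; rewrite !mem_nth// (ltn_trans _ il).
Qed.

Lemma closed_edges_inj1 l e e' : uniq l ->
  e \in closed_edges l -> e' \in closed_edges l -> e.1 = e'.1 -> e = e'.
Proof.
move=> ul /(closed_edges_nth 0)[i il ->] /(closed_edges_nth 0)[j jl ->] /=.
by move=> /eqP; rewrite nth_uniq// => /eqP ->.
Qed.

Lemma succ_mod_inj n i j : (i < n)%N -> (j < n)%N ->
  (i.+1 %% n = j.+1 %% n)%N -> i = j.
Proof.
move=> il jl /eqP; rewrite -(addn1 i) -(addn1 j) eqn_modDr !modn_small//.
by move/eqP.
Qed.

Lemma closed_edges_inj2 l e e' : uniq l ->
  e \in closed_edges l -> e' \in closed_edges l -> e.2 = e'.2 -> e = e'.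
Proof.
move=> ul /(closed_edges_nth 0)[i il ->] /(closed_edges_nth 0)[j jl ->] /=.
move=> /eqP; rewrite nth_uniq// ?ltn_mod ?(leq_ltn_trans _ il)// => /eqP.
by move=> /(succ_mod_inj il jl) ->.
Qed.

(** The indices of the two edges are cyclic successors of each other, so the length of [l] divides
    2. Length 2 is excluded, and length 1 leaves the degenerate edge, hence the conclusion [A = B]
    instead of a contradiction. *)
Lemma closed_edges_reverse l A B : uniq l -> size l != 2%N ->
  (A, B) \in closed_edges l -> (B, A) \in closed_edges l -> A = B.
Proof.
move=> ul l2 /(closed_edges_nth 0)[i il [Ai Bi]].
move=> /(closed_edges_nth 0)[j jl [Bj Aj]].
have l0 : (0 < size l)%N by exact: leq_ltn_trans il.
have ji : (i.+1 %% size l = j)%N.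
  by apply/eqP; rewrite -(nth_uniq 0 _ _ ul) ?ltn_mod// -Bi -Bj.
have ij : (j.+1 %% size l = i)%N.
  by apply/eqP; rewrite -(nth_uniq 0 _ _ ul) ?ltn_mod// -Ai -Aj.
suff : i = j by move=> E; rewrite Ai Bj E.
move: ji; have [si|si] := eqVneq i.+1 (size l).
  rewrite si modnn => j0; move: ij; rewrite -j0.
  have [<-|s1] := eqVneq 1%N (size l); first by rewrite modnn.
  rewrite modn_small; last by rewrite ltn_neqAle s1.
  by move=> i1; move: si l2; rewrite -i1 => <-.
have {}si : (i.+1 < size l)%N by rewrite ltn_neqAle si.
rewrite modn_small// => ji; move: ij; rewrite -ji.
have [si2|si2] := eqVneq i.+2 (size l).
  by rewrite si2 modnn => i0; move: l2; rewrite -si2 -i0.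
rewrite modn_small; last by rewrite ltn_neqAle si2.
by move=> ii; have := leqnSn i.+1; rewrite ii ltnn.
Qed.

Lemma edges_inj1 p f f' : uniq p ->
  f \in edges p -> f' \in edges p -> f.1 = f'.1 -> f = f'.
Proof.
move=> up /(edges_nth 0)[i il ->] /(edges_nth 0)[j jl ->] /= /eqP.
by rewrite nth_uniq// ?(ltnW il) ?(ltnW jl)// => /eqP ->.
Qed.

Lemma edges_inj2 p f f' : uniq p ->
  f \in edges p -> f' \in edges p -> f.2 = f'.2 -> f = f'.
Proof.
move=> up /(edges_nth 0)[i il ->] /(edges_nth 0)[j jl ->] /= /eqP.
by rewrite nth_uniq// => /eqP[->].
Qed.

Lemma edges_reverse p A B : uniq p ->
  (A, B) \in edges p -> (B, A) \notin edges p.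
Proof.
move=> up /(edges_nth 0)[i il [Ai Bi]]; apply/negP.
move=> /(edges_nth 0)[j jl [Bj Aj]].
have /eqP : nth 0 p i.+1 = nth 0 p j by rewrite -Bi.
have /eqP : nth 0 p i = nth 0 p j.+1 by rewrite -Ai.
rewrite !nth_uniq// ?(ltnW il) ?(ltnW jl)// => /eqP ij /eqP ji.
by have := leqnSn j.+1; rewrite -{2}ij ji ltnn.
Qed.

(** The second endpoints form [rot 1 l], a permutation of the first endpoints. *)
Lemma sum_closed_edges (V : zmodType) (F : plane R -> V) l :
  \sum_(e <- closed_edges l) (F e.2 - F e.1) = 0.
Proof.
have sz : size l = size (rot 1 l) by rewrite size_rot.
rewrite sumrB -(big_map snd xpredT F) -(big_map fst xpredT F).
rewrite -/(unzip1 _) -/(unzip2 _) unzip1_zip ?unzip2_zip ?sz//.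
by rewrite (perm_big l) ?perm_rot// subrr.
Qed.

End Edges.

(** * Counting intersection points in general position *)

Section GeneralPosition.
Context {R : realType}.
Implicit Types (A B C O P Q X Y : plane R) (l p : seq (plane R)).
Implicit Types (S : set (plane R)) (e f s : plane R * plane R).

(** Equal segments would put A on the line through the endpoints of [s], making three distinct
    points collinear. *)
Lemma segment_neq S A C s : general_position S -> S A -> S s.1 -> S s.2 ->
  s.1 != s.2 -> A != s.1 -> A != s.2 -> segment A C <> segment s.1 s.2.
Proof.
move=> gp SA S1 S2 s12 A1 A2 E.
have /eqP[] := general_position_orient gp SA S1 S2 A1 A2 s12.
by apply: segment_orient; rewrite -E; exact: segment_left.
Qed.

Lemma segmentC A B : segment A B = segment B A.
Proof.
suff H C D : segment C D `<=` segment D C by rewrite eqEsubset; split; exact: H.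
move=> X /segmentP[t /andP[t0 t1] ->]; apply/segmentP; exists (1 - t).
  by apply/andP; split; lra.
by apply: planeP; rewrite !point_atE; ring.
Qed.

(* Sharing both endpoints is the only way in which two segments in general
   position can coincide as sets. *)
Definition new_endpoint s s' : bool := (s.1 != s'.1) && (s.1 != s'.2)
  || (s.2 != s'.1) && (s.2 != s'.2).

Lemma new_endpoint_segment S s s' : general_position S -> joins S s -> joins S s' ->
  new_endpoint s s' -> segment s.1 s.2 <> segment s'.1 s'.2.
Proof.
move=> gp [S1 S2 _] [S1' S2' n] /orP[] /andP[n1 n2].
  exact: (segment_neq gp).
by rewrite segmentC; exact: (segment_neq gp).
Qed.

Lemma not_three_concurrent S s1 s2 s3 X : general_position S ->
  joins S s1 -> joins S s2 -> joins S s3 ->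
  new_endpoint s1 s2 -> new_endpoint s1 s3 -> new_endpoint s2 s3 ->
  open_segment s1.1 s1.2 X -> open_segment s2.1 s2.2 X ->
  open_segment s3.1 s3.2 X -> False.
Proof.
move=> gp j1 j2 j3 n12 n13 n23 X1 X2 X3.
apply: (gp.2 s1 s2 s3) => //; [| | |by exists X];
  exact: (new_endpoint_segment gp).
Qed.

Section EdgePair.
Variables (S : set (plane R)) (A B P Q : plane R).
Hypotheses (gp : general_position S) (SA : S A) (SB : S B) (SP : S P) (SQ : S Q).
Hypotheses (PQ : P != Q) (AP : A != P) (AQ : A != Q) (BP : B != P) (BQ : B != Q).

Let oA : orient A P Q != 0. Proof. exact: (general_position_orient gp). Qed.
Let oB : orient B P Q != 0. Proof. exact: (general_position_orient gp). Qed.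

Let oP : A != B -> orient P A B != 0.
Proof. by move=> AB; apply: (general_position_orient gp); rewrite // eq_sym. Qed.

Let oQ : A != B -> orient Q A B != 0.
Proof. by move=> AB; apply: (general_position_orient gp); rewrite // eq_sym. Qed.

Lemma crosses_neq : crosses A B P Q -> A != B.
Proof.
by apply: contraTneq => ->; rewrite /crosses orient_eq0r mul0r ltxx.
Qed.

Lemma segment_meet_gp X : segment A B X -> segment P Q X ->
  crosses A B P Q /\ X = meet A B P Q.
Proof.
(* A closed line with one vertex has the degenerate edge AA; its only point is off the line PQ. *)
have [AB|AB] := eqVneq A B; last by apply: segment_meet; rewrite ?oP ?oQ.
move=> /segmentP[t _ ->] /segment_orient.
have -> : point_at A B t = A by apply: planeP; rewrite point_atE -AB; ring.
by move/eqP; rewrite (negPf oA).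
Qed.

(** A crossing contributes 1 or -1 to the winding number; modulo 2 its sign disappears. *)
Lemma angle_defect_mod :
  eqmod2 ((2 * pi)^-1 * angle_defect A B P Q) (crosses A B P Q)%:R.
Proof.
have p0 : (2 * pi : R) != 0 by rewrite lt0r_neq0// mulr_gt0// pi_gt0.
case: (boolP (crosses A B P Q)) => [cr|ncr].
  have AB := crosses_neq cr.
  have [->|->] := angle_defect_crosses (oQ AB) (oP AB) oA oB cr.
    by exists 0; rewrite mulVf// subrr mulr0.
  by exists (-1); rewrite mulrN mulVf// rmorphN /=; ring.
exists 0; rewrite mulr0 subr0.
have [E|AB] := eqVneq A B.
  by rewrite /angle_defect -E !angle_self//; ring.
by rewrite (angle_defect_not_crosses (oQ AB) (oP AB) oA oB ncr) mulr0.
Qed.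

End EdgePair.

Lemma eqmod2_refl (x : R) : eqmod2 x x.
Proof. by exists 0; rewrite subrr mulr0. Qed.

Lemma eqmod2D (x y x' y' : R) :
  eqmod2 x y -> eqmod2 x' y' -> eqmod2 (x + x') (y + y').
Proof.
move=> [k kE] [k' kE']; exists (k + k'); rewrite rmorphD /= mulrDr -kE -kE'.
by ring.
Qed.

Lemma eqmod2_sum (I : eqType) (r : seq I) (F G : I -> R) :
  (forall i, i \in r -> eqmod2 (F i) (G i)) ->
  eqmod2 (\sum_(i <- r) F i) (\sum_(i <- r) G i).
Proof.
move=> FG; rewrite [X in eqmod2 X _]big_seq_cond [X in eqmod2 _ X]big_seq_cond.
apply: (big_ind2 (@eqmod2 R)) => [|x y x' y'|i /andP[]].
- exact: eqmod2_refl.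
- exact: eqmod2D.
- by move=> /FG.
Qed.

Definition edges_cross e f := crosses e.1 e.2 f.1 f.2.

Lemma windingB l P Q : winding l Q - winding l P =
  \sum_(e <- closed_edges l) (2 * pi)^-1 * angle_defect e.1 e.2 P Q.
Proof.
rewrite /winding -mulrBr -sumrB -mulr_sumr; congr (_ * _).
apply/eqP; rewrite -subr_eq0 -sumrB.
(* The zero is replaced by the telescoping sum of [angle P A Q], which supplies the angles at the
   vertices of [l]. *)
rewrite -[X in _ == X](sum_closed_edges (fun A => angle P A Q) l); apply/eqP.
by apply: eq_bigr => e _; rewrite /angle_defect; ring.
Qed.

Section LinePair.
Variables (l p : seq (plane R)).
Hypotheses (u : uniq (l ++ p)) (gp : general_position [set` l ++ p]).

Let S := [set` l ++ p].

Let lp_neq A P : A \in l -> P \in p -> A != P.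
Proof.
move: u; rewrite cat_uniq => /and3P[_ /hasPn lp _] Al Pp.
by apply: contraNneq (lp _ Pp) => <-.
Qed.

Let ul : uniq l. Proof. by move: u; rewrite cat_uniq => /and3P[]. Qed.
Let up : uniq p. Proof. by move: u; rewrite cat_uniq => /and3P[]. Qed.

Let Sl A : A \in l -> S A. Proof. by rewrite /S /= mem_cat => ->. Qed.
Let Sp A : A \in p -> S A. Proof. by rewrite /S /= mem_cat orbC => ->. Qed.

Lemma edges_neq f : f \in edges p -> f.1 != f.2.
Proof.
move=> /(edges_nth 0)[i il ->] /=.
by rewrite nth_uniq// ?(ltnW il)// neq_ltn ltnSn.
Qed.

Lemma edge_pair_meet e f X : e \in closed_edges l -> f \in edges p ->
  segment e.1 e.2 X -> segment f.1 f.2 X ->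
  edges_cross e f /\ X = meet e.1 e.2 f.1 f.2.
Proof.
move=> el fp; have /andP[e1 e2] := mem_closed_edges el.
have /andP[f1 f2] := mem_edges fp.
by apply: (segment_meet_gp gp); rewrite ?edges_neq ?lp_neq//;
  (exact: Sl || exact: Sp).
Qed.

Lemma windingB_mod f : f \in edges p ->
  eqmod2 (winding l f.2 - winding l f.1)
    (\sum_(e <- closed_edges l) (edges_cross e f)%:R).
Proof.
move=> fp; rewrite windingB; apply: eqmod2_sum => e el.
have /andP[e1 e2] := mem_closed_edges el; have /andP[f1 f2] := mem_edges fp.
by apply: (angle_defect_mod gp); rewrite ?edges_neq ?lp_neq//;
  (exact: Sl || exact: Sp).
Qed.

(** A closed line with two vertices traverses one segment twice. Off that segment its winding number
    is 0, while [p] may meet the segment in a single point, so the parity statement would fail. *)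
Hypothesis l2 : size l != 2%N.

Definition crossing_pairs :=
  [seq ef <- [seq (e, f) | e <- closed_edges l, f <- edges p] |
    edges_cross ef.1 ef.2].

Definition pair_meet (ef : (plane R * plane R) * (plane R * plane R)) :=
  meet ef.1.1 ef.1.2 ef.2.1 ef.2.2.

Lemma crossing_pairsP e f : (e, f) \in crossing_pairs ->
  [/\ e \in closed_edges l, f \in edges p & edges_cross e f].
Proof.
by rewrite mem_filter /= => /andP[cr /allpairsP[[e0 f0] [/= ? ? [ee ff]]]];
  rewrite ee ff in cr *.
Qed.

Lemma crossing_pairs_uniq : uniq crossing_pairs.
Proof.
apply: filter_uniq; apply: allpairs_uniq.
- by rewrite zip_uniql.
- by rewrite zip_uniql.
- by move=> [? ?] [? ?].
Qed.

Let joins_closed e : e \in closed_edges l -> e.1 != e.2 -> joins S e.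
Proof.
by move=> /mem_closed_edges/andP[e1 e2] e12; split; rewrite ?e12 //; apply: Sl.
Qed.

Let joins_edge f : f \in edges p -> joins S f.
Proof.
move=> fp; have /andP[? ?] := mem_edges fp.
by split; [exact: Sp|exact: Sp|exact: edges_neq].
Qed.

(** Distinct edges differ in their initial points and in their final points, so they can share both
    endpoints only by being reverses of each other. *)
Let new_closed e e' : e \in closed_edges l -> e' \in closed_edges l ->
  e.1 != e.2 -> e != e' -> new_endpoint e e'.
Proof.
case: e e' => [A B] [C D] el el' /= AB n.
rewrite /new_endpoint /=.
have AC : A != C by apply: contra_neq n => AC; exact: (closed_edges_inj1 ul el el').
have BD : B != D by apply: contra_neq n => BD; exact: (closed_edges_inj2 ul el el').
rewrite AC BD andbT /=; have [AD|//] := eqVneq A D.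
have [BC|//] := eqVneq B C; move: el'; rewrite -AD -BC => el'.
by move: AB; rewrite (closed_edges_reverse ul l2 el el') eqxx.
Qed.

Let new_edge f f' : f \in edges p -> f' \in edges p ->
  f != f' -> new_endpoint f f'.
Proof.
case: f f' => [A B] [C D] fp fp' /= n; rewrite /new_endpoint /=.
have AC : A != C by apply: contra_neq n => AC; exact: (edges_inj1 up fp fp').
have BD : B != D by apply: contra_neq n => BD; exact: (edges_inj2 up fp fp').
rewrite AC BD andbT /=; have [AD|//] := eqVneq A D.
have [BC|//] := eqVneq B C; move: fp'; rewrite -AD -BC.
by rewrite (negPf (edges_reverse up fp)).
Qed.

Let new_mixed e f : e \in closed_edges l -> f \in edges p -> new_endpoint e f.
Proof.
move=> /mem_closed_edges/andP[e1 e2] /mem_edges/andP[f1 f2].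
by rewrite /new_endpoint !lp_neq.
Qed.

(** Two distinct crossing pairs with the same meeting point would yield three different segments
    with a common interior point: two edges of one line and one of the other. *)
Lemma pair_meet_inj : {in crossing_pairs &, injective pair_meet}.
Proof.
move=> [e f] [e' f'] /crossing_pairsP[el fp cr] /crossing_pairsP[el' fp' cr'].
rewrite /pair_meet /= => E.
have [Xe Xf] := crosses_meet cr; have [Xe' Xf'] := crosses_meet cr'.
rewrite -E in Xe' Xf'.
have ej := joins_closed el (crosses_neq cr).
have ej' := joins_closed el' (crosses_neq cr').
have [fj fj'] := (joins_edge fp, joins_edge fp').
have [ee|en] := eqVneq e e'.
  have [ff|fn] := eqVneq f f'; first by rewrite ee ff.
  exfalso; apply: (not_three_concurrent gp ej fj fj' _ _ _ Xe Xf Xf').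
  - exact: new_mixed.
  - by rewrite ee; exact: new_mixed.
  - exact: new_edge.
exfalso; apply: (not_three_concurrent gp ej ej' fj _ _ _ Xe Xe' Xf).
- exact: new_closed (crosses_neq cr) en.
- exact: new_mixed.
- exact: new_mixed.
Qed.

Lemma polyline_meetE : closed_polyline l `&` polyline p =
  [set` map pair_meet crossing_pairs].
Proof.
apply/seteqP; split=> [X [[e el Xe] [f fp Xf]]|X /mapP[[e f] efc ->]] /=.
  have [cr XE] := edge_pair_meet el fp Xe Xf.
  apply/mapP; exists (e, f); last by [].
  by rewrite mem_filter cr; apply/allpairsP; exists (e, f).
have [el fp cr] := crossing_pairsP efc; have [Xe Xf] := crosses_meet cr.
by split; [exists e|exists f] => //; exact: open_segmentW.
Qed.

Lemma npoints_seq (s : seq (plane R)) : uniq s -> npoints [set` s] = size s.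
Proof.
move=> us; rewrite /npoints.
have -> : [set` s] = [set` seq_fset tt s].
  by apply: eq_set => X; rewrite (seq_fsetE tt s).
by rewrite set_fsetK size_seq_fset undup_id.
Qed.

Lemma npoints_meet : npoints (closed_polyline l `&` polyline p) =
  (\sum_(f <- edges p) \sum_(e <- closed_edges l) edges_cross e f)%N.
Proof.
rewrite polyline_meetE npoints_seq; last first.
  by rewrite map_inj_in_uniq ?crossing_pairs_uniq//; exact: pair_meet_inj.
(* The sums are exchanged so that the outer one runs over the edges of [p], matching the telescoping
   of winding numbers along [p]. *)
rewrite size_map size_filter -sum1_count big_mkcond big_allpairs exchange_big /=.
by apply: eq_bigr => f _; apply: eq_bigr => e _; case: edges_cross.
Qed.

End LinePair.

Lemma sum_edges (F : plane R -> R) P0 q :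
  \sum_(f <- edges (P0 :: q)) (F f.2 - F f.1) = F (last P0 q) - F P0.
Proof.
elim: q P0 => [|P q IH] P0; first by rewrite /edges /= big_nil subrr.
rewrite /edges /= big_cons -[zip _ _]/(edges (P :: q)) IH /=.
by rewrite addrC addrA subrK.
Qed.

Lemma winding_diff_mod l P0 q : size l != 2%N -> uniq (l ++ P0 :: q) ->
  general_position [set` l ++ P0 :: q] ->
  eqmod2 (winding l (last P0 q) - winding l P0)
    (npoints (closed_polyline l `&` polyline (P0 :: q)))%:R.
Proof.
move=> l2 u gp; rewrite npoints_meet// -sum_edges natr_sum.
apply: eqmod2_sum => f fp; rewrite natr_sum; exact: (windingB_mod u gp).
Qed.

End GeneralPosition.

(** * Points outside the convex hull *)

Section ConvexHull.
Context {R : realType}.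
Implicit Types (A B C O P Q X : plane R) (l : seq (plane R)).
Implicit Types (K : set (plane R)) (t : R).

Lemma convex_point_at K A B t : @convex_set R (plane R) K -> K A -> K B ->
  0 <= t <= 1 -> K (point_at A B t).
Proof.
move=> cK KA KB /andP[t0 t1].
(* The points are swapped because [conv] gives the weight [t] to its first argument. *)
have := cK B A (Itv01 t0 t1); rewrite !inE => /(_ KB KA).
congr K; rewrite /conv /= /point_at addrC; congr (_ *: _ + _ *: _).
Qed.

Lemma convex_setP K : (forall A B t, K A -> K B -> 0 <= t <= 1 ->
  K (point_at A B t)) -> @convex_set R (plane R) K.
Proof.
move=> cK A B t; rewrite !inE => KA KB.
have -> : conv t A B = point_at B A t%:num :> plane R by rewrite /point_at addrC.
by apply: cK => //; apply/andP.
Qed.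

(** The three orientations are barycentric coordinates of O: (a + b + c) O = a A + b B + c C. Two
    successive convex combinations realize this weighted mean. *)
Lemma convex_triangle K O A B C : @convex_set R (plane R) K ->
  K A -> K B -> K C -> 0 < orient O A B -> 0 < orient O B C ->
  0 < orient O C A -> K O.
Proof.
move=> cK KA KB KC; set c := orient O A B; set a := orient O B C.
set b := orient O C A => c0 a0 b0.
have KD : K (point_at A B (b / (a + b))).
  apply: convex_point_at => //.
  by apply/andP; split; [apply: divr_ge0|rewrite ler_pdivrMr]; lra.
suff -> : O = point_at (point_at A B (b / (a + b))) C (c / (a + b + c)).
  apply: convex_point_at => //.
  by apply/andP; split; [apply: divr_ge0|rewrite ler_pdivrMr]; lra.
have ab : a + b != 0 by apply: lt0r_neq0; lra.
have abc : a + b + c != 0 by apply: lt0r_neq0; lra.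
have E i : (a + b + c) * O 0 i = a * A 0 i + b * B 0 i + c * C 0 i ->
    O 0 i = point_at (point_at A B (b / (a + b))) C (c / (a + b + c)) 0 i.
  move=> e; apply: (mulfI abc); rewrite e !point_atE.
  by field; rewrite ab abc.
by apply: planeP; apply: E; rewrite /a /b /c /orient; ring.
Qed.

(** The sign of the orientation seen from O is a tournament on the vertices. Without cyclic triples,
    which would surround O, it is transitive and has a least element. *)
Lemma exists_first_vertex O l : l != [::] ->
  {in l &, forall A B, A != B -> orient O A B != 0} ->
  (forall A B C, A \in l -> B \in l -> C \in l -> 0 < orient O A B ->
     0 < orient O B C -> ~ 0 < orient O C A) ->
  exists2 M, M \in l & {in l, forall A, 0 <= orient O M A}.
Proof.
elim: l => [//|B l IH] _ o0 tr.
have orientC X Y : orient O X Y = - orient O Y X by rewrite /orient; ring.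
have [->|ln] := eqVneq l [::].
  exists B; rewrite ?mem_head// => A; rewrite mem_seq1 => /eqP ->.
  by rewrite orient_eq0r.
have ins X : X \in l -> X \in B :: l by rewrite inE orbC => ->.
have [X Y Xl Yl|X Y Z Xl Yl Zl|M Ml MP] := IH ln.
- exact: o0 (ins _ Xl) (ins _ Yl).
- exact: tr (ins _ Xl) (ins _ Yl) (ins _ Zl).
have [MB|BM] := lerP 0 (orient O M B).
  exists M; first exact: ins.
  by move=> A; rewrite inE => /orP[/eqP ->//|]; exact: MP.
rewrite orientC oppr_lt0 in BM.
exists B; first exact: mem_head.
move=> A; rewrite inE => /orP[/eqP ->|Al]; first by rewrite orient_eq0r.
have [AM|AM] := eqVneq A M; first by rewrite AM ltW.
have MA : 0 < orient O M A.
  by rewrite lt0r MP// andbT o0 ?ins// eq_sym.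
rewrite leNgt; apply/negP; rewrite orientC oppr_lt0.
apply: (tr B M A) => //; [exact: mem_head|exact: ins|exact: ins].
Qed.

Lemma closed_polyline_vertex l A : A \in l -> closed_polyline l A.
Proof.
have sz : size l = size (rot 1 l) by rewrite size_rot.
move=> Al; have : A \in unzip1 (closed_edges l) by rewrite unzip1_zip ?sz.
by move=> /mapP[e el ->]; exists e => //; exact: segment_left.
Qed.

(* Seen from O, the vertices lie in a half-plane; measuring directions from
   its extreme vertex makes the sum of angles telescope. *)
Lemma winding_outside_hull l O : O \notin l ->
  {in l &, forall A B, A != B -> orient O A B != 0} ->
  ~ convex_hull (closed_polyline l) O -> winding l O = 0.
Proof.
move=> Ol o0 hull; have [->|ln] := eqVneq l [::].
  by rewrite /winding /closed_edges /= big_nil mulr0.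
have lO A : A \in l -> A != O by move=> Al; apply: contraNneq Ol => <-.
have [|M Ml MP] := exists_first_vertex ln o0.
  move=> A B C Al Bl Cl AB BC CA; apply: hull => K [cK lK].
  by apply: (convex_triangle cK _ _ _ AB BC CA); apply/lK/closed_polyline_vertex.
rewrite /winding (_ : \sum_(_ <- _) _ = 0) ?mulr0//.
rewrite -[RHS](sum_closed_edges (angle M O) l); apply: eq_big_seq => e el.
have p0 := pi_gt0 R.
have itv A : A \in l -> 0 <= angle M O A < pi.
  move=> Al; have := MP _ Al; rewrite le_eqVlt => /orP[/eqP o|o]; last first.
    by have /andP[t1 ->] := angle_orient_gt0 (lO _ Ml) (lO _ Al) o; rewrite ltW.
  have [<-|MA] := eqVneq M A; first by rewrite angle_self ?lO ?lexx.
  by move: (o0 _ _ Ml Al MA); rewrite -o eqxx.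
have /andP[e1 e2] := mem_closed_edges el.
have [/andP[t1 t2] _] := angleP (lO _ e1) (lO _ e2).
have /andP[u1 u2] := itv _ e1; have /andP[v1 v2] := itv _ e2.
suff : angle M O e.1 + angle e.1 O e.2 - angle M O e.2 = 0 by lra.
by apply: (cos_eq1 (angle_add (lO _ Ml) (lO _ e1) (lO _ e2))); lra.
Qed.

(** The sum [M] bounds all coordinates of the vertices, so the hull lies in the square of half-side
    [M]. Its diagonal is at most [4 * M], so a hull point cannot be farther than that from a
    vertex. *)
Lemma far_outside_hull l : exists r, forall O : plane R,
  (forall X, closed_polyline l X -> r < euclid_dist O X) ->
  ~ convex_hull (closed_polyline l) O.
Proof.
pose M : R := \sum_(A <- l) (`|A 0 0| + `|A 0 1|).
have M0 : 0 <= M by apply: sumr_ge0 => A _; rewrite addr_ge0.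
exists (4 * M) => O far hull.
have Ml A : A \in l -> `|A 0 0| <= M /\ `|A 0 1| <= M.
  move=> Al; suff : `|A 0 0| + `|A 0 1| <= M.
    by have := normr_ge0 (A 0 0); have := normr_ge0 (A 0 1); split; lra.
  rewrite /M (big_rem A)//= lerDl; apply: sumr_ge0 => B _; exact: addr_ge0.
pose box : set (plane R) := [set X | `|X 0 0| <= M /\ `|X 0 1| <= M].
have cbox : @convex_set R (plane R) box.
  apply: convex_setP => A B t [/=] /ler_normlP[a1 a2] /ler_normlP[a3 a4].
  move=> [/ler_normlP[b1 b2] /ler_normlP[b3 b4]] /andP[t0 t1].
  by split; apply/ler_normlP; rewrite point_atE; split; nra.
have [|o0 o1] := hull box.
  split=> // X [e el] /segmentP[t t01 ->].
  have /andP[e1 e2] := mem_closed_edges el.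
  by apply: (convex_point_at cbox _ _ t01); exact: Ml.
(* Without vertices the distance condition is vacuous, but the hull of the empty set is empty. *)
case: l => [|A l] in M M0 far hull Ml box cbox o0 o1 *.
  apply: (hull set0); split; first by apply: convex_setP.
  by move=> X [].
have [a0 a1] := Ml A (mem_head _ _).
have := far _ (closed_polyline_vertex (mem_head A l)); apply/negP.
rewrite -leNgt /euclid_dist.
have M4 : 0 <= 4 * M by rewrite mulr_ge0.
rewrite -(ger0_norm M4) -sqrtr_sqr ler_wsqrtr// !big_ord_recl big_ord0 addr0.
have -> : lift ord0 ord0 = 1 :> 'I_2 by apply/val_inj.
move: o0 o1 a0 a1 => /ler_normlP[? ?] /ler_normlP[? ?] /ler_normlP[? ?] /ler_normlP[? ?].
nra.
Qed.

End ConvexHull.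

Theorem mainTheorem3 (R : realType) (l : seq (plane R)) (hl : size l != 2%N) :
  (* (a) *)
  (forall (P0 : plane R) (q : seq (plane R)),
     let p := P0 :: q in let P1 := last P0 q in
     uniq (l ++ p) -> general_position [set` l ++ p] ->
     finite_set (closed_polyline l `&` polyline p) /\
     eqmod2 (winding l P1 - winding l P0)
       (npoints (closed_polyline l `&` polyline p))%:R) /\
  (* (b), P0 sufficiently far from l *)
  (exists r : R, forall (P0 : plane R) (q : seq (plane R)),
     let p := P0 :: q in let P1 := last P0 q in
     uniq (l ++ p) -> general_position [set` l ++ p] ->
     (forall X, closed_polyline l X -> r < euclid_dist P0 X) ->
     eqmod2 (winding l P1) (npoints (closed_polyline l `&` polyline p))%:R) /\
  (* (b), P0 outside the convex hull of l *)
  (forall (P0 : plane R) (q : seq (plane R)),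
     let p := P0 :: q in let P1 := last P0 q in
     uniq (l ++ p) -> general_position [set` l ++ p] ->
     ~ convex_hull (closed_polyline l) P0 ->
     eqmod2 (winding l P1) (npoints (closed_polyline l `&` polyline p))%:R).
Proof.
(* Both forms of (b) reduce to this one, since a sufficiently far point lies outside the hull. *)
have outside P0 q : uniq (l ++ P0 :: q) ->
    general_position [set` l ++ P0 :: q] ->
    ~ convex_hull (closed_polyline l) P0 ->
    eqmod2 (winding l (last P0 q))
      (npoints (closed_polyline l `&` polyline (P0 :: q)))%:R.
  move=> u gp hull; have := winding_diff_mod hl u gp.
  have P0l : P0 \notin l.
    move: u; rewrite cat_uniq => /and3P[_ /hasPn lp _].
    exact: lp (mem_head _ _).
  have lP0 A : A \in l -> P0 != A by move=> Al; apply: contraNneq P0l => ->.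
  rewrite (winding_outside_hull P0l _ hull) ?subr0// => A B Al Bl AB.
  by apply: (general_position_orient gp); rewrite ?lP0//= mem_cat ?mem_head ?Al ?Bl ?orbT.
split; last split=> //.
- move=> P0 q p P1 u gp; split; last exact: winding_diff_mod.
  rewrite (polyline_meetE u gp); exact: finite_seq.
- have [r far] := far_outside_hull l; exists r => P0 q p P1 u gp Pfar.
  by apply: outside => //; exact: far.
Qed.
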